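(* Let $C_t$ be a $t$-doped Clifford circuit on $n$ qubits written as $C_t=D^\dagger c_tDV$, with $D,V$ Clifford unitaries and $c_t$ a $t$-doped Clifford circuit acting nontrivially only on a subsystem of $t\le n$ qubits. Let $|\psi_t\rangle=C_t|0\rangle^{\otimes n}$ and $\psi_t=|\psi_t\rangle\langle\psi_t|$. Let the qubits be bipartitioned as $E\cup F$, let $n_Y=t$, and assume $n_Y\le n_F$. Let $Y\subset F$ be a set of $n_Y$ qubits, let $T_{\pi_Y}$ be the qubit-permutation unitary such that $c_t^Y:=T_{\pi_Y}c_tT_{\pi_Y}^\dagger$ acts nontrivially only on $Y$, and let $W:=T_{\pi_Y}D$ and $\mathcal E(\cdot):=\mathrm{tr}_Y\big(W(\cdot)W^\dagger\big)$. Then $W$ moves the $t$ non-Clifford gates into $Y$, i.e. $W|\psi_t\rangle=c_t^Y|\Phi\rangle$ with $|\Phi\rangle:=T_{\pi_Y}DV|0\rangle^{\otimes n}$ a stabilizer state, and after tracing out $Y$ the stabilizer entropy on $E$ vanishes: $$M_E[\mathcal E(\psi_t)]=0 .$$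
   Context: The system consists of $n$ qubits, $\mathcal H=(\mathbb C^2)^{\otimes n}=\mathcal H_E\otimes\mathcal H_F$, where $E,F$ consist of $n_E,n_F$ qubits, $n=n_E+n_F$. A $t$-doped Clifford circuit is a circuit of Clifford gates into which $t$ non-Clifford gates ($T$-gates) have been inserted. For a (possibly mixed) state $\sigma$ on $m$ qubits with $\delta=2^m$, and $\mathbb P$ the set of $4^m$ Pauli strings (tensor products of $I,X,Y,Z$), define the stabilizer purity $\mathrm{SP}(\sigma)=\sum_{P\in\mathbb P}\big(\delta^{-1}\mathrm{tr}(P\sigma)^2\big)^2$, the purity $\mathrm{Pur}(\sigma)=\mathrm{tr}(\sigma^2)$, $w(\sigma)=\delta\,\mathrm{SP}(\sigma)/\mathrm{Pur}(\sigma)$, and the ($2$-Rényi) stabilizer entropy $M(\sigma)=-\log_2 w(\sigma)$. A stabilizer state is a state $\sigma$ with $M(\sigma)=0$. For a state $\sigma$ on a set of qubits containing $E$, $M_E[\sigma]:=M(\sigma_E)$, where $\sigma_E$ is the reduced state of $\sigma$ on $E$ (the partial trace over all other qubits). *)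

(* Defs.v *)
From HB Require Import structures.
From mathcomp Require Import all_boot all_order all_algebra all_fingroup.
From mathcomp Require Import reals exp trigo.
From mathcomp Require Import complex.
Set Implicit Arguments. Unset Strict Implicit. Unset Printing Implicit Defensive.
Import Order.TTheory GRing.Theory Num.Theory.
Local Open Scope ring_scope.
Local Open Scope sesquilinear_scope.
Local Open Scope complex_scope.

(* MathComp world, over the complex numbers R[i] for R : realType.  Qubits are
   labelled by a finite type Q, so that a set S of qubits is again a system,
   labelled by [sub S]. *)

Definition basis (Q : finType) := {ffun Q -> 'I_2}.

Definition op (R : realType) (Q : finType) := 'M[R[i]]_#|basis Q|.
Definition ket (R : realType) (Q : finType) := 'cV[R[i]]_#|basis Q|.

Definition sub (Q : finType) (S : {set Q}) : finType := {q : Q | q \in S}.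

Definition restr (Q : finType) (S : {set Q}) (x : basis Q) : basis (sub S) :=
  [ffun q => x (val q)].

Definition agree_off (Q : finType) (S : {set Q}) (x y : basis Q) : bool :=
  [forall q in ~: S, x q == y q].

Section Operators.
Variables (R : realType) (Q : finType).

(* f x y = <x| A |y> *)
Definition mkop (f : basis Q -> basis Q -> R[i]) : op R Q :=
  \matrix_(i, j) f (enum_val i) (enum_val j).

Definition entry (A : op R Q) (x y : basis Q) : R[i] :=
  A (enum_rank x) (enum_rank y).

End Operators.

Section Subsystems.
Variables (R : realType) (Q : finType).

Definition tensor (f : Q -> 'M[R[i]]_2) : op R Q :=
  mkop (fun x y => \prod_q f q (x q) (y q)).

Definition zero_ket : ket R Q := delta_mx (enum_rank [ffun=> 0]) 0.

Definition proj (v : ket R Q) : op R Q := v *m v^t*.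

(* |x> is sent to |x o s^-1>: the content of qubit q is moved to qubit s q. *)
Definition perm_op (s : {perm Q}) : op R Q :=
  mkop (fun y x => [forall q, y (s q) == x q]%:R).

(* B acting on the qubits of S, tensored with the identity on the others *)
Definition extend (S : {set Q}) (B : op R (sub S)) : op R Q :=
  mkop (fun x y => if agree_off S x y
                   then entry B (restr S x) (restr S y) else 0).

Definition acts_only_on (S : {set Q}) (A : op R Q) : Prop :=
  exists B : op R (sub S), A = extend B.

(* The reduced operator on S: the partial trace over all qubits outside S. *)
Definition reduce (S : {set Q}) (A : op R Q) : op R (sub S) :=
  \matrix_(i, j) \sum_(a : basis Q) \sum_(b : basis Q |
     [&& restr S a == enum_val i, restr S b == enum_val j
       & agree_off S a b]) entry A a b.

Definition ptrace (S : {set Q}) (A : op R Q) : op R (sub (~: S)) :=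
  reduce (~: S) A.

(* Indices 0, 1, 2, 3 stand for I, X, Y, Z. *)
Definition pauli1 (k : 'I_4) : 'M[R[i]]_2 :=
  nth 0 [:: 1%:M;
            delta_mx 0 1 + delta_mx 1 0;
            'i *: (delta_mx 1 0 - delta_mx 0 1);
            delta_mx 0 0 - delta_mx 1 1] k.

Definition pauli (p : {ffun Q -> 'I_4}) : op R Q := tensor (fun q => pauli1 (p q)).

Definition pauli_group (A : op R Q) : Prop :=
  exists (k : nat) (p : {ffun Q -> 'I_4}), A = 'i ^+ k *: pauli p.

(* The unitary normalizer of the Pauli group; as that group is finite, mapping
   it into itself is the same as mapping it onto itself. *)
Definition clifford (U : op R Q) : Prop :=
  U \is unitarymx /\
  forall A, pauli_group A -> pauli_group (U *m A *m U^t*).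

(* diag (1, e^(i pi/4)) *)
Definition T1 : 'M[R[i]]_2 :=
  delta_mx 0 0 + (cos (pi / 4) +i* sin (pi / 4)) *: delta_mx 1 1.

Definition T_gate (q0 : Q) : op R Q :=
  tensor (fun q => if q == q0 then T1 else 1%:M).

(* Unitaries of circuits made of Clifford gates and exactly t T-gates. *)
Inductive doped_clifford : nat -> op R Q -> Prop :=
| doped_id : doped_clifford 0 1%:M
| doped_clifford_gate t A U :
    doped_clifford t A -> clifford U -> doped_clifford t (U *m A)
| doped_T_gate t A q :
    doped_clifford t A -> doped_clifford t.+1 (T_gate q *m A).

Definition is_state (s : op R Q) : Prop :=
  [/\ s^t* = s, forall v : ket R Q, 0 <= (v^t* *m s *m v) 0 0 & \tr s = 1].

Definition dim : R[i] := (2 ^ #|Q|)%:R.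

Definition stab_purity (s : op R Q) : R[i] :=
  \sum_(p : {ffun Q -> 'I_4}) (dim^-1 * (\tr (pauli p *m s)) ^+ 2) ^+ 2.

Definition purity (s : op R Q) : R[i] := \tr (s *m s).

Definition weight (s : op R Q) : R[i] := dim * stab_purity s / purity s.

(* For a state, the weight is a positive real number, so taking the real part
   is harmless and the value of ln outside the positive reals is irrelevant. *)
Definition stab_entropy (s : op R Q) : R :=
  - (ln (complex.Re (weight s)) / ln 2).

Definition stabilizer_state (s : op R Q) : Prop :=
  is_state s /\ stab_entropy s = 0.

End Subsystems.

(* M_E of a state on a set A of qubits; meaningful when E is contained in A. *)
Definition entropy_on (R : realType) (Q : finType) (A E : {set Q})
    (s : op R (sub A)) : R :=
  stab_entropy (reduce [set q : sub A | val q \in E] s).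

Arguments zero_ket {R Q}.

(* Main.v *)
Require Import Defs.
From HB Require Import structures.
From mathcomp Require Import all_boot all_order all_algebra all_fingroup.
From mathcomp Require Import reals exp trigo.
From mathcomp Require Import complex.
Import Order.TTheory GRing.Theory Num.Theory.
Local Open Scope ring_scope.
Local Open Scope sesquilinear_scope.

(* A state whose Pauli coefficients tr (P s) all square to 0 or 1 has stabilizer
   entropy 0: then tr (P s)^4 = tr (P s)^2, so by the Parseval identity
   sum_P tr (P s)^2 = 2^n tr (s^2) the weight is 1.  Pure stabilizer states have
   this property.  It is inherited by reduced states, since the partial trace is
   adjoint to B |-> B (x) 1, which maps Pauli strings to Pauli strings.  Finally,
   W psi = c_t^Y Phi, where the unitary c_t^Y commutes with operators supported
   off Y and hence does not change the reduced state there. *)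

Set Implicit Arguments. Unset Strict Implicit. Unset Printing Implicit Defensive.

(** * Matrix entries indexed by basis labels, tensor products and qubit permutations *)

Section Operators.
Variables (R : realType) (Q : finType).
Implicit Types (A B U s : op R Q) (x y z : basis Q).

Lemma entryP A B : (forall x y, entry A x y = entry B x y) -> A = B.
Proof.
move=> eqAB; apply/matrixP => i j.
by have := eqAB (enum_val i) (enum_val j); rewrite /entry !enum_valK.
Qed.

Lemma entry_mkop (f : basis Q -> basis Q -> R[i]) x y : entry (mkop f) x y = f x y.
Proof. by rewrite /entry mxE !enum_rankK. Qed.

Lemma sum_enum_rank (F : 'I_#|basis Q| -> R[i]) :
  \sum_i F i = \sum_x F (enum_rank x).
Proof. by rewrite (reindex enum_rank) //; apply: onW_bij; apply: enum_rank_bij. Qed.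

Lemma entry_mul A B x y : entry (A *m B) x y = \sum_z entry A x z * entry B z y.
Proof. by rewrite /entry mxE sum_enum_rank. Qed.

Lemma entry_adj A x y : entry (A^t*) x y = (entry A y x)^*.
Proof. by rewrite /entry !mxE. Qed.

Lemma entry1 x y : entry (1%:M : op R Q) x y = (x == y)%:R.
Proof. by rewrite /entry mxE (inj_eq enum_rank_inj). Qed.

Lemma entryZ a A x y : entry (a *: A) x y = a * entry A x y.
Proof. by rewrite /entry mxE. Qed.

Lemma trace_entry A : \tr A = \sum_x entry A x x.
Proof. by rewrite /mxtrace sum_enum_rank. Qed.

Lemma trace_mul_entry A B :
  \tr (A *m B) = \sum_x \sum_y entry A x y * entry B y x.
Proof. by rewrite trace_entry; apply: eq_bigr => x _; rewrite entry_mul. Qed.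

Lemma adj_mul m p q (A : 'M[R[i]]_(m, p)) (B : 'M[R[i]]_(p, q)) :
  (A *m B)^t* = B^t* *m A^t*.
Proof. by rewrite trmx_mul map_mxM. Qed.

Lemma unitary_adjK U : U \is unitarymx -> U^t* *m U = 1%:M.
Proof. by rewrite -trmxC_unitary => /unitarymxP; rewrite trmxCK. Qed.

(* [mul_unitarymx] at type [op]: applying the general lemma directly to concrete
   operators makes unification extremely slow. *)
Lemma unitary_mul A B :
  A \is unitarymx -> B \is unitarymx -> A *m B \is unitarymx.
Proof.
move=> /unitarymxP AK /unitarymxP BK; apply/unitarymxP.
by rewrite adj_mul !mulmxA -[A *m B *m _]mulmxA BK mulmx1.
Qed.

Lemma proj_mul U (v : ket R Q) : proj (U *m v) = U *m proj v *m U^t*.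
Proof. by rewrite /proj adj_mul !mulmxA. Qed.

Lemma trace_zero_ket A :
  \tr (A *m proj zero_ket) = entry A [ffun=> 0] [ffun=> 0].
Proof.
rewrite /proj mulmxA mxtrace_mulC trace_mx11 mxE (bigD1 (enum_rank [ffun=> 0])) //=.
rewrite big1 ?addr0 => [|i /negPf ne0]; last by rewrite !mxE ne0 conjC0 mul0r.
rewrite !mxE !eqxx conjC1 mul1r (bigD1 (enum_rank [ffun=> 0])) //=.
rewrite big1 ?addr0 => [|i /negPf ne0]; last by rewrite !mxE ne0 mulr0.
by rewrite mxE !eqxx mulr1.
Qed.

Lemma entry_tensor (f : Q -> 'M[R[i]]_2) x y :
  entry (tensor f) x y = \prod_q f q (x q) (y q).
Proof. exact: entry_mkop. Qed.

Lemma tensor1 : tensor (fun=> 1%:M) = 1%:M :> op R Q.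
Proof.
apply: entryP => x y; rewrite entry_tensor entry1.
have [-> | /eqP/ffunP ne_xy] := eqVneq.
  by rewrite big1 // => q _; rewrite mxE eqxx.
have /existsP [q ne_q] : [exists q, x q != y q].
  by apply: contra_notT ne_xy => /existsPn eq_xy q;
  have := eq_xy q; rewrite negbK => /eqP.
by rewrite (bigD1 q) //= mxE (negPf ne_q) mul0r.
Qed.

Lemma tensor_mul (f g : Q -> 'M[R[i]]_2) :
  tensor f *m tensor g = tensor (fun q => f q *m g q) :> op R Q.
Proof.
apply: entryP => x y; rewrite entry_mul entry_tensor.
under [RHS]eq_bigr => q _ do rewrite mxE.
(* Distributivity: a product over qubits of sums over a bit is a sum over all intermediate basis
   labels [z]. *)
rewrite bigA_distr_bigA /=; apply: eq_bigr => z _.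
by rewrite !entry_tensor -big_split.
Qed.

Lemma tensor_adj (f : Q -> 'M[R[i]]_2) :
  (tensor f)^t* = tensor (fun q => (f q)^t*) :> op R Q.
Proof.
apply: entryP => x y; rewrite entry_adj !entry_tensor rmorph_prod.
by apply: eq_bigr => q _; rewrite !mxE.
Qed.

Lemma eq_tensor (f g : Q -> 'M[R[i]]_2) : f =1 g -> tensor f = tensor g :> op R Q.
Proof.
by move=> eq_fg; apply: entryP => x y; rewrite !entry_tensor;
  under eq_bigr do rewrite eq_fg.
Qed.

Lemma trace_tensor (f : Q -> 'M[R[i]]_2) : \tr (tensor f : op R Q) = \prod_q \tr (f q).
Proof.
rewrite trace_entry bigA_distr_bigA /=.
by apply: eq_bigr => x _; rewrite entry_tensor.
Qed.

(** Row [x] of the permutation matrix has a single 1, in the column labelled by [x] composed with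
    [pi], so only one intermediate label survives. *)
Lemma entry_perm_mul (pi : {perm Q}) A x y :
  entry (perm_op R pi *m A) x y = entry A [ffun q => x (pi q)] y.
Proof.
rewrite entry_mul (bigD1 [ffun q => x (pi q)]) //= big1 ?addr0 => [|z ne_z].
  rewrite entry_mkop; case: forallP => [_|[]]; first by rewrite mul1r.
  by move=> q; rewrite ffunE.
rewrite entry_mkop; case: forallP => [eq_z|_]; last by rewrite mul0r.
by case/eqP: ne_z; apply/ffunP => q; rewrite ffunE (eqP (eq_z q)).
Qed.

Lemma entry_perm_conj (pi : {perm Q}) A x y :
  entry (perm_op R pi *m A *m (perm_op R pi)^t*) x y =
  entry A [ffun q => x (pi q)] [ffun q => y (pi q)].
Proof.
(* Taking adjoints turns the right multiplication into a second left multiplication, so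
   [entry_perm_mul] serves for both sides. *)
have -> : perm_op R pi *m A *m (perm_op R pi)^t* =
    (perm_op R pi *m (perm_op R pi *m A)^t*)^t*.
  by rewrite adj_mul trmxCK.
by rewrite entry_adj entry_perm_mul entry_adj conjCK entry_perm_mul.
Qed.

Lemma perm_op_unitary (pi : {perm Q}) : perm_op R pi \is unitarymx.
Proof.
apply/unitarymxP; apply: entryP => x y.
have := entry_perm_conj pi 1%:M x y; rewrite mulmx1 => ->; rewrite !entry1.
congr (nat_of_bool _)%:R; apply/eqP/eqP => [/ffunP eq_xy|-> //].
by apply/ffunP => q; have := eq_xy ((pi^-1)%g q); rewrite !ffunE permKV.
Qed.

Lemma perm_op_tensor (pi : {perm Q}) (f : Q -> 'M[R[i]]_2) :
  perm_op R pi *m tensor f *m (perm_op R pi)^t* = tensor (fun q => f ((pi^-1)%g q)).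
Proof.
apply: entryP => x y; rewrite entry_perm_conj !entry_tensor.
rewrite [RHS](reindex_inj (perm_inj (s := pi))) /=.
by apply: eq_bigr => q _; rewrite !ffunE permK.
Qed.

End Operators.

(** * Pauli strings: orthogonality, completeness, and the entropy of flat spectra *)

Section Pauli.
Variables (R : realType).

Lemma pauli1E (k : 'I_4) (a b : 'I_2) :
  pauli1 R k a b =
  match nat_of_ord k with
  | 0 => (a == b)%:R
  | 1 => (a != b)%:R
  | 2 => if a == b then 0 else if a == 0 then - 'i else 'i
  | _ => if a == b then (-1) ^+ a else 0
  end.
Proof.
case: k => [[|[|[|[|//]]]] lt_k]; rewrite /pauli1 /= !mxE ?eqxx;
case: a => [[|[|//]] lt_a]; case: b => [[|[|//]] lt_b];
by rewrite -?val_eqE /= ?subr0 ?sub0r ?addr0 ?add0r ?mulr0 ?mulrN ?mulr1 ?expr0 ?expr1.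
Qed.

Lemma pauli1_adj k : (pauli1 R k)^t* = pauli1 R k.
Proof.
apply/matrixP => a b; rewrite !mxE !pauli1E.
case: k => [[|[|[|[|//]]]] lt_k] /=; case: a => [[|[|//]] lt_a];
case: b => [[|[|//]] lt_b]; rewrite -?val_eqE /=;
by rewrite ?conjC0 ?conjC1 ?rmorphN /= ?conjCi ?opprK ?conjC1 ?expr1 ?rmorphN /= ?conjC1.
Qed.

Lemma mulCii : 'i * 'i = -1 :> R[i].
Proof. by rewrite -expr2 sqrCi. Qed.

Lemma trace_pauli1_mul k l :
  \tr (pauli1 R k *m pauli1 R l) = if k == l then 2 else 0.
Proof.
rewrite /mxtrace !big_ord_recl big_ord0 !mxE !big_ord_recl !big_ord0 !pauli1E.
case: k => [[|[|[|[|//]]]] lt_k]; case: l => [[|[|[|[|//]]]] lt_l];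
rewrite -!val_eqE /=;
by rewrite ?(mulr0, mul0r, mulr1, mul1r, addr0, add0r, mulNr, mulrN, opprK,
  expr0, expr1, subrr, addNr, oppr0, mulCii).
Qed.

(** One-qubit completeness relation: the sum of P (x) P over the four Pauli matrices is twice the
    swap operator. It is the local ingredient of the Parseval identity. *)
Lemma sum_pauli1 (a b c d : 'I_2) :
  \sum_k pauli1 R k a b * pauli1 R k c d = if (a == d) && (b == c) then 2 else 0.
Proof.
rewrite !big_ord_recl big_ord0 !pauli1E.
case: a => [[|[|//]] ?]; case: b => [[|[|//]] ?];
case: c => [[|[|//]] ?]; case: d => [[|[|//]] ?];
rewrite -!val_eqE /=;
by rewrite ?(mulr0, mul0r, mulr1, mul1r, addr0, add0r, mulNr, mulrN, opprK,
  expr0, expr1, subrr, addNr, oppr0, mulCii).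
Qed.

Variable Q : finType.
Implicit Types (A B U s : op R Q) (p q : {ffun Q -> 'I_4}).

Lemma pauli_adj p : (pauli R p)^t* = pauli R p.
Proof. by rewrite tensor_adj; apply: eq_tensor => q; apply: pauli1_adj. Qed.

Lemma pauli0 : pauli R [ffun=> 0] = 1%:M :> op R Q.
Proof. by rewrite -tensor1; apply: eq_tensor => q; rewrite ffunE. Qed.

Lemma trace_pauli_mul p q :
  \tr (pauli R p *m pauli R q) = if p == q then Defs.dim R Q else 0.
Proof.
rewrite tensor_mul trace_tensor; have [->|ne_pq] := eqVneq p q.
  under eq_bigr => x _ do rewrite trace_pauli1_mul eqxx.
  by rewrite prodr_const /Defs.dim natrX.
have /existsP [x ne_x] : [exists x, p x != q x].
  apply: contraNT ne_pq => /existsPn eq_pq; apply/eqP/ffunP => x.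
  by have := eq_pq x; rewrite negbK => /eqP.
by rewrite (bigD1 x) //= trace_pauli1_mul (negPf ne_x) mul0r.
Qed.

(** The upper left entry is 1 for I and Z and 0 for X and Y, so the product over the qubits is again
    0 or 1, without any sign. *)
Lemma entry_pauli0_bool p :
  exists b : bool, entry (pauli R p) [ffun=> 0] [ffun=> 0] = b%:R.
Proof.
rewrite entry_tensor; elim/big_ind: _ => [|u v [b ->] [c ->]|q _]; first by exists true.
  by exists (b && c); rewrite -natrM mulnb.
rewrite !ffunE pauli1E eqxx; case: (p q) => [[|[|[|[|//]]]] lt_k] /=.
- by exists true.
- by exists false.
- by exists false.
- by exists true; rewrite expr0.
Qed.

(** By completeness, summing P (x) P over all strings gives [dim] times the swap of two copies of
    the system, and the trace of that swap against A (x) A is tr (A^2). *)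
Lemma pauli_parseval A :
  \sum_p \tr (pauli R p *m A) ^+ 2 = Defs.dim R Q * purity A.
Proof.
(* The sum over strings factors over the qubits, which reduces it to [sum_pauli1]. *)
have pauli_sum (x y z w : basis Q) :
    \sum_p entry (pauli R p) x y * entry (pauli R p) z w =
    if (x == w) && (y == z) then Defs.dim R Q else 0.
  transitivity (\prod_q \sum_k pauli1 R k (x q) (y q) * pauli1 R k (z q) (w q)).
    rewrite bigA_distr_bigA; apply: eq_bigr => p _.
    by rewrite !entry_tensor -big_split.
  under eq_bigr => q _ do rewrite sum_pauli1.
  case: ifPn => [/andP [/eqP -> /eqP ->]|].
    by under eq_bigr do rewrite !eqxx; rewrite prodr_const /Defs.dim natrX.
  rewrite negb_and => ne; have /existsP [q ne_q] :
      [exists q, ~~ ((x q == w q) && (y q == z q))].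
    apply: contraTT ne => /existsPn eq_q; rewrite negb_or !negbK.
    by apply/andP; split; apply/eqP/ffunP => q; have := eq_q q;
      rewrite negbK => /andP [/eqP ? /eqP ?].
  by rewrite (bigD1 q) //= (negPf ne_q) mul0r.
transitivity (\sum_x \sum_y \sum_z \sum_w
    (\sum_p entry (pauli R p) x y * entry (pauli R p) z w) * (entry A y x * entry A w z)).
  under eq_bigr => p _ do rewrite expr2 trace_mul_entry big_distrlr /=.
  under eq_bigr => p _.
    under eq_bigr => x _.
      under eq_bigr => z _ do rewrite big_distrlr /=.
      rewrite exchange_big /=; over.
    over.
  rewrite exchange_big; apply: eq_bigr => x _; rewrite exchange_big; apply: eq_bigr => y _.
  rewrite exchange_big; apply: eq_bigr => z _; rewrite exchange_big; apply: eq_bigr => w _.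
  by rewrite mulr_suml; apply: eq_bigr => p _; rewrite mulrACA.
rewrite /purity trace_mul_entry mulr_sumr; apply: eq_bigr => x _.
rewrite mulr_sumr; apply: eq_bigr => y _.
(* The swap leaves only the terms with z = y and w = x. *)
rewrite (bigD1 y) //= (bigD1 x) //= pauli_sum !eqxx /= [X in _ + X]big1; last first.
  move=> z ne_z; rewrite big1 // => w _; rewrite pauli_sum [y == z]eq_sym (negPf ne_z).
  by rewrite andbF mul0r.
rewrite big1 ?addr0 => [|w ne_w]; first by rewrite [entry A y x * _]mulrC.
by rewrite pauli_sum [x == w]eq_sym (negPf ne_w) mul0r.
Qed.

(** The condition is on squares, so that the signs of stabilizer coefficients are allowed. *)
Definition flat_pauli_spectrum s :=
  forall p, \tr (pauli R p *m s) ^+ 2 \in [:: 0; 1 : R[i]].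

Lemma dim_neq0 : Defs.dim R Q != 0.
Proof. by rewrite pnatr_eq0 expn_eq0. Qed.

Lemma flat_stab_entropy s :
  \tr s = 1 -> flat_pauli_spectrum s -> stab_entropy s = 0.
Proof.
move=> tr_s flat_s.
have c4 p : (\tr (pauli R p *m s) ^+ 2) ^+ 2 = \tr (pauli R p *m s) ^+ 2.
  by have := flat_s p; rewrite !inE => /orP [] /eqP ->; rewrite ?expr0n ?expr1n.
have c_ge0 p : 0 <= \tr (pauli R p *m s) ^+ 2.
  by have := flat_s p; rewrite !inE => /orP [] /eqP ->; rewrite ?ler01.
(* The identity string alone contributes tr (s)^2 = 1 to a sum of nonnegative terms; hence the
   Parseval sum is positive, and dividing by the purity in [weight] is legitimate. *)
have pur_neq0 : purity s != 0.
  have := pauli_parseval s; rewrite (bigD1 [ffun=> 0]) //= pauli0 mul1mx tr_s expr1n.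
  move=> eq_pur; apply/eqP => pur0.
  suff : 0 < Defs.dim R Q * purity s by rewrite pur0 mulr0 ltxx.
  by rewrite -eq_pur ltr_pwDl // sumr_ge0.
rewrite /stab_entropy.
suff -> : weight s = 1 by rewrite ln1 mul0r oppr0.
rewrite /weight /stab_purity.
under eq_bigr do rewrite exprMn c4.
(* One factor [dim] comes from [weight] and one from Parseval; they cancel the squared normalization
   of [stab_purity]. *)
rewrite -mulr_sumr pauli_parseval exprVn expr2 invfM.
by rewrite !mulrA mulfV ?dim_neq0 // mul1r mulVf ?dim_neq0 // mul1r mulfV.
Qed.

End Pauli.

(** * Clifford unitaries, pure stabilizer states, and unitarity of doped circuits *)

Section Clifford.
Variables (R : realType) (Q : finType).
Implicit Types (A B U : op R Q) (p q : {ffun Q -> 'I_4}).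

Lemma trace_adj A : \tr (A^t* ) = (\tr A)^*.
Proof.
rewrite !trace_entry rmorph_sum /=.
by apply: eq_bigr => x _; rewrite entry_adj.
Qed.

(** Passage to the Heisenberg picture: the conjugation moves from the state to the observable. *)
Lemma trace_conj A B U :
  \tr (A *m (U *m B *m U^t*)) = \tr (U^t* *m A *m U *m B).
Proof. by rewrite mulmxA mxtrace_mulC !mulmxA. Qed.

Lemma clifford_unitary U : clifford U -> U \is unitarymx.
Proof. by case. Qed.

Lemma clifford_mul U A : clifford U -> clifford A -> clifford (U *m A).
Proof.
move=> [U_unitary U_pauli] [A_unitary A_pauli]; split; first exact: unitary_mul.
move=> B B_pauli.
have -> : U *m A *m B *m (U *m A)^t* = U *m (A *m B *m A^t*) *m U^t*.
  by rewrite adj_mul !mulmxA.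
exact/U_pauli/A_pauli.
Qed.

Lemma perm_op_clifford (pi : {perm Q}) : clifford (perm_op R pi).
Proof.
split=> [|_ [k [p ->]]]; first exact: perm_op_unitary.
exists k, [ffun q => p ((pi^-1)%g q)].
rewrite -scalemxAr -scalemxAl perm_op_tensor; congr (_ *: _).
by apply: eq_tensor => q; rewrite ffunE.
Qed.

Lemma normCiX k : `|'i ^+ k| = 1 :> R[i].
Proof. by rewrite normrX normCi expr1n. Qed.

(* A Clifford unitary permutes the Pauli strings up to phases, so its inverse
   conjugates them to Pauli strings up to phases as well. *)
Lemma clifford_adj_pauli U p : clifford U ->
  exists (c : R[i]) q, `|c| = 1 /\ U^t* *m pauli R p *m U = c *: pauli R q.
Proof.
move=> [U_unitary U_pauli].
have conj_adjK A : U^t* *m (U *m A *m U^t*) *m U = A.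
  by rewrite !mulmxA unitary_adjK // mul1mx -mulmxA unitary_adjK // mulmx1.
have /fin_all_exists [f f_conj] q : exists q' : {ffun Q -> 'I_4},
    exists k, U *m pauli R q *m U^t* = 'i ^+ k *: pauli R q'.
  have [|k [q' eq_q]] := U_pauli (pauli R q); last by exists q', k.
  by exists 0%N, q; rewrite scale1r.
have f_inj : injective f.
  (* Two distinct strings with the same image would be proportional; orthogonality would then make
     tr (P P) vanish, whereas it equals [dim]. *)
  move=> q q' eq_f; apply/eqP; apply: contraT => ne_q.
  have [k eq_k] := f_conj q; have [l eq_l] := f_conj q'.
  have : \tr (pauli R q *m pauli R q) = 0.
    have eq_q : pauli R q = ('i ^+ k / 'i ^+ l) *: pauli R q'.
      rewrite -[LHS]conj_adjK -[pauli R q' in RHS]conj_adjK eq_k eq_l eq_f.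
      by rewrite -!scalemxAr -!scalemxAl scalerA divfK // expf_neq0 ?neq0Ci.
    rewrite {1}eq_q -scalemxAl linearZ /= trace_pauli_mul [q' == q]eq_sym.
    by rewrite (negPf ne_q) mulr0.
  by rewrite trace_pauli_mul eqxx => /eqP; rewrite (negPf (dim_neq0 R Q)).
(* An injective self-map of the finite set of strings is bijective, so [p] has a preimage [g p]. *)
have [g _ gK] := injF_bij f_inj.
have [k eq_k] := f_conj (g p); exists ('i ^+ k)^-1, (g p); split.
  by rewrite normfV normCiX invr1.
rewrite -[pauli R (g p)]conj_adjK eq_k gK -scalemxAr -scalemxAl scalerA.
by rewrite mulVf ?scale1r // expf_neq0 ?neq0Ci.
Qed.

(* The coefficient of a Pauli string is real, and it is a phase times 0 or 1. *)
Lemma clifford_flat_pauli_spectrum U :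
  clifford U -> flat_pauli_spectrum (proj (U *m zero_ket)).
Proof.
move=> U_clifford p; have [c [q [c_phase eq_q]]] := clifford_adj_pauli p U_clifford.
set t := \tr _.
have t_real : t^* = t.
  by rewrite -trace_adj adj_mul pauli_adj /proj adj_mul trmxCK mxtrace_mulC.
have [b eq_b] := entry_pauli0_bool R q.
have eq_t : t = c * b%:R.
  by rewrite /t proj_mul trace_conj eq_q trace_zero_ket entryZ eq_b.
(* As t is real, t^2 is the squared modulus of t, in which the phase [c] disappears. *)
rewrite expr2 -{2}t_real -normCK eq_t normrM c_phase mul1r normr_nat -natrX.
by case: b {eq_b eq_t}; rewrite !inE ?expr1n ?expr0n ?eqxx ?orbT.
Qed.

Lemma trace_proj_unitary U : U \is unitarymx -> \tr (proj (U *m zero_ket)) = 1.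
Proof.
move=> U_unitary; rewrite proj_mul mxtrace_mulC mulmxA unitary_adjK //.
by rewrite trace_zero_ket entry1 eqxx.
Qed.

Lemma proj_is_state (v : ket R Q) : \tr (proj v) = 1 -> is_state (proj v).
Proof.
split=> // [|w]; first by rewrite /proj adj_mul trmxCK.
have -> : w^t* *m proj v *m w = (w^t* *m v) *m (w^t* *m v)^t*.
  by rewrite adj_mul trmxCK /proj !mulmxA.
by rewrite mxE big_ord1 [X in _ * X]mxE [X in X^*]mxE mul_conjC_ge0.
Qed.

Lemma T1_unitary : T1 R \is unitarymx.
Proof.
apply/unitarymxP/matrixP => a b; rewrite !mxE !big_ord_recl big_ord0 !mxE.
case: a => [[|[|//]] ?]; case: b => [[|[|//]] ?]; rewrite -!val_eqE /=.
all: rewrite ?(mulr0, mul0r, mulr1, add0r, addr0, rmorph0, rmorph1) //.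
by rewrite -normCK normc_def /= cos2Dsin2 sqrtr1 expr1n.
Qed.

Lemma T_gate_unitary (q0 : Q) : T_gate R q0 \is unitarymx.
Proof.
apply/unitarymxP; rewrite tensor_adj tensor_mul -tensor1; apply: eq_tensor => q.
case: ifP => _; first exact/unitarymxP/T1_unitary.
by rewrite trmx1 map_mx1 mulmx1.
Qed.

Lemma doped_clifford_unitary t U : doped_clifford t U -> U \is unitarymx.
Proof.
elim=> [|{}t A V _ A_unitary V_clifford|{}t A q _ A_unitary].
- by apply/unitarymxP; rewrite trmx1 map_mx1 mulmx1.
- exact: unitary_mul (clifford_unitary V_clifford) A_unitary.
- exact: unitary_mul (T_gate_unitary q) A_unitary.
Qed.

End Clifford.

(** * Partial trace as the adjoint of extension by the identity *)

Section Subsystems.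
Variables (R : realType) (Q : finType) (S : {set Q}).
Implicit Types (A : op R Q) (B : op R (sub S)) (C : op R (sub (~: S))).

Lemma agree_offP (x y : basis Q) :
  reflect (forall q, q \notin S -> x q = y q) (agree_off S x y).
Proof.
apply: (iffP forall_inP) => eq_xy q; first by rewrite -in_setC => /eq_xy /eqP.
by rewrite in_setC => /eq_xy ->.
Qed.

Lemma agree_off_sym (x y : basis Q) : agree_off S x y = agree_off S y x.
Proof. by apply: eq_forallb_in => q _; rewrite eq_sym. Qed.

Lemma entry_extend B x y :
  entry (extend B) x y =
  if agree_off S x y then entry B (restr S x) (restr S y) else 0.
Proof. exact: entry_mkop. Qed.

Lemma entry_reduce A x y : entry (reduce S A) x y =
  \sum_a \sum_(b | [&& restr S a == x, restr S b == y & agree_off S a b]) entry A a b.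
Proof. by rewrite /entry mxE !enum_rankK. Qed.

Lemma trace_mul_reduce A B : \tr (B *m reduce S A) = \tr (extend B *m A).
Proof.
rewrite !trace_mul_entry.
(* With the side conditions moved into the summand, the sums can be exchanged freely; for fixed [a]
   and [b] only y = [restr S a] and x = [restr S b] then contribute. *)
transitivity (\sum_x \sum_y \sum_a \sum_b
    if [&& restr S a == y, restr S b == x & agree_off S a b]
    then entry B x y * entry A a b else 0).
  apply: eq_bigr => x _; apply: eq_bigr => y _; rewrite entry_reduce mulr_sumr.
  by apply: eq_bigr => a _; rewrite mulr_sumr big_mkcond.
under eq_bigr do rewrite exchange_big.
rewrite exchange_big.
under eq_bigr => a _ do under eq_bigr => x _ do rewrite exchange_big.
under eq_bigr => a _ do rewrite exchange_big.
rewrite exchange_big /=; apply: eq_bigr => b _; apply: eq_bigr => a _.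
rewrite (bigD1 (restr S b)) //= (bigD1 (restr S a)) //= !eqxx entry_extend.
rewrite agree_off_sym /=.
rewrite big1 ?addr0 => [|y ne_y]; last by rewrite eq_sym (negPf ne_y).
rewrite big1 ?addr0 => [|x ne_x]; first by case: ifP => _; rewrite ?mul0r.
by rewrite big1 // => y _; rewrite [_ == x]eq_sym (negPf ne_x) andbF.
Qed.

(** The padding value 0 is the index of the identity matrix. *)
Definition extend_pauli (p : {ffun sub S -> 'I_4}) : {ffun Q -> 'I_4} :=
  [ffun q => if insub q is Some u then p u else 0].

(** The identity factors outside [S] multiply to the indicator of [agree_off], and the remaining
    factors form the smaller string. *)
Lemma extend_pauliE p : extend (pauli R p) = pauli R (extend_pauli p).
Proof.
apply: entryP => x y; rewrite entry_extend !entry_tensor.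
rewrite (bigID (mem S)) /= [in RHS]big_sub.
have -> : \prod_(q | q \notin S) pauli1 R (extend_pauli p q) (x q) (y q) =
    (agree_off S x y)%:R.
  have [/agree_offP eq_xy|] := boolP (agree_off S x y).
    rewrite big1 // => q q_notin; rewrite ffunE insubN // pauli1E eq_xy //.
    by rewrite eqxx.
  rewrite /agree_off => /forall_inPn [q q_in ne_q]; rewrite in_setC in q_in.
  by rewrite (bigD1 q) //= ffunE insubN // pauli1E (negPf ne_q) mul0r.
case: ifP => _; last by rewrite mulr0.
rewrite mulr1; apply: eq_bigr => u _; rewrite !ffunE.
by rewrite valK.
Qed.

Lemma reduce_flat_pauli_spectrum A :
  flat_pauli_spectrum A -> flat_pauli_spectrum (reduce S A).
Proof. by move=> flat_A p; rewrite trace_mul_reduce extend_pauliE. Qed.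

(** This is the adjunction [trace_mul_reduce] tested on the identity string, whose padding is again
    the identity string. *)
Lemma trace_reduce A : \tr (reduce S A) = \tr A.
Proof.
rewrite -[reduce S A]mul1mx -[A in RHS]mul1mx -!pauli0 trace_mul_reduce extend_pauliE.
congr (\tr (pauli R _ *m A)); apply/ffunP => q; rewrite !ffunE.
by case: insub => // u; rewrite ffunE.
Qed.

End Subsystems.

(** * Operators on disjoint sets of qubits *)

Section DisjointSubsystems.
Variables (R : realType) (Q : finType).
Implicit Types (S T : {set Q}).

(** The resulting formula is symmetric under exchanging (S, B) with (T, C), which yields
    commutation. *)
Lemma entry_extend_mul S T (B : op R (sub S)) (C : op R (sub T)) x z :
  [disjoint S & T] ->
  entry (extend B *m extend C) x z =
  if agree_off (S :|: T) x z
  then entry B (restr S x) (restr S z) * entry C (restr T x) (restr T z) else 0.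
Proof.
(* The only possible intermediate label: it must equal [x] off [S] and [z] off [T], hence [z] on [S]
   by disjointness. *)
move=> ST; pose y : basis Q := [ffun q => if q \in S then z q else x q].
have xy : agree_off S x y.
  by apply/agree_offP => q /negPf q_notin; rewrite ffunE q_notin.
have agree_yz : agree_off T y z = agree_off (S :|: T) x z.
  apply/agree_offP/agree_offP => eq_z q; rewrite ?inE.
    by rewrite negb_or => /andP [/negPf q_S /eq_z]; rewrite ffunE q_S.
  move=> q_T; rewrite ffunE; case: ifPn => // q_S.
  by apply: eq_z; rewrite inE negb_or q_S.
have restrS : restr S y = restr S z.
  by apply/ffunP => u; rewrite !ffunE (valP u).
have restrT : restr T y = restr T x.
  by apply/ffunP => u; rewrite !ffunE (disjointFl ST (valP u)).
rewrite entry_mul (bigD1 y) //= big1 ?addr0 => [|w ne_w].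
  by rewrite !entry_extend xy agree_yz restrS restrT; case: ifP => //; rewrite mulr0.
rewrite !entry_extend; case: ifPn => [/agree_offP xw|]; last by rewrite mul0r.
case: ifPn => [/agree_offP wz|]; last by rewrite mulr0.
case/eqP: ne_w; apply/ffunP => q; rewrite ffunE; case: ifPn => [q_S|/xw //].
by rewrite wz // (disjointFr ST q_S).
Qed.

Lemma extend_commute S T (B : op R (sub S)) (C : op R (sub T)) :
  [disjoint S & T] -> extend B *m extend C = extend C *m extend B.
Proof.
move=> ST; apply: entryP => x z.
rewrite entry_extend_mul // [RHS]entry_extend_mul 1?disjoint_sym //.
by rewrite setUC mulrC.
Qed.

Lemma trace_mul_reduce_unitary S T (U A : op R Q) (B : op R (sub S)) :
  [disjoint S & T] -> acts_only_on T U -> U \is unitarymx ->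
  \tr (B *m reduce S (U *m A *m U^t*)) = \tr (B *m reduce S A).
Proof.
move=> ST [C eq_U] U_unitary; rewrite !trace_mul_reduce.
have BU : extend B *m U = U *m extend B by rewrite eq_U; exact: extend_commute.
rewrite trace_conj -[_ *m extend B *m U]mulmxA BU mulmxA.
by rewrite (unitary_adjK U_unitary) mul1mx.
Qed.

End DisjointSubsystems.

Theorem proposition2 (R : realType) (n t : nat) (Ct D V ct : op R 'I_n)
    (S E F Y : {set 'I_n}) (piY : {perm 'I_n})
    (Ct_doped : doped_clifford t Ct)
    (D_clifford : clifford D) (V_clifford : clifford V)
    (ct_doped : doped_clifford t ct)
    (t_le_n : (t <= n)%N)
    (S_card : #|S| = t) (ct_on_S : acts_only_on S ct)
    (Ct_eq : Ct = D^t* *m ct *m D *m V)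
    (EF_disjoint : [disjoint E & F]) (EF_cover : E :|: F = [set: 'I_n])
    (nY_le_nF : (t <= #|F|)%N)
    (Y_sub_F : Y \subset F) (Y_card : #|Y| = t)
    (piY_moves : acts_only_on Y (perm_op R piY *m ct *m (perm_op R piY)^t*)) :
  let psi : ket R 'I_n := Ct *m zero_ket in
  let ctY : op R 'I_n := perm_op R piY *m ct *m (perm_op R piY)^t* in
  let W : op R 'I_n := perm_op R piY *m D in
  let Phi : ket R 'I_n := perm_op R piY *m D *m V *m zero_ket in
  let channel (A : op R 'I_n) := ptrace Y (W *m A *m W^t*) in
  [/\ W *m psi = ctY *m Phi,
      stabilizer_state (proj Phi)
    & entropy_on E (channel (proj psi)) = 0].
Proof.
move=> psi ctY W Phi channel.
have [D_unitary piY_unitary] := (clifford_unitary D_clifford, perm_op_unitary R piY).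
(* On the left D cancels against its adjoint in [Ct_eq]; on the right the adjoint of the permutation
   inside [ctY] cancels against the one in [Phi]. *)
have W_psi : W *m psi = ctY *m Phi.
  rewrite /psi Ct_eq /ctY /Phi /W !mulmxA.
  rewrite -[perm_op R piY *m D *m _]mulmxA (unitarymxP D_unitary) mulmx1.
  by rewrite -[_ *m _^t* *m perm_op R piY]mulmxA (unitary_adjK piY_unitary) mulmx1.
have U_clifford : clifford (perm_op R piY *m D *m V).
  exact: clifford_mul (clifford_mul (perm_op_clifford R piY) D_clifford) V_clifford.
have Phi_flat : flat_pauli_spectrum (proj Phi) by exact: clifford_flat_pauli_spectrum.
have Phi_trace : \tr (proj Phi) = 1 by exact/trace_proj_unitary/clifford_unitary.
have ctY_unitary : ctY \is unitarymx.
  apply: unitary_mul; last by rewrite trmxC_unitary.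
  exact: unitary_mul piY_unitary (doped_clifford_unitary ct_doped).
split=> //; first by split; [exact: proj_is_state | exact: flat_stab_entropy].
(* Off [Y], the channel output and the stabilizer state [Phi] give the same trace against every
   operator. The trace and the Pauli spectrum of the output can thus be read off [Phi]. *)
have reduced_trace (B : op R (sub (~: Y))) :
    \tr (B *m channel (proj psi)) = \tr (B *m reduce (~: Y) (proj Phi)).
  rewrite /channel -proj_mul W_psi proj_mul; apply: trace_mul_reduce_unitary piY_moves _ => //.
  by rewrite disjoint_sym disjoints_subset setCK.
apply: flat_stab_entropy.
  by rewrite trace_reduce -[channel _]mul1mx reduced_trace mul1mx trace_reduce.
(* Flatness is inherited twice: from all qubits to the complement of [Y], and from there to [E]. *)
apply: reduce_flat_pauli_spectrum => p; rewrite reduced_trace.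
exact: reduce_flat_pauli_spectrum.
Qed.
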